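(* Let $H$ be a subcubic graph that is a spanning subgraph of a contractibly orderable graph, and let $H^*$ denote the graph obtained from $H$ by adding a new vertex $a$ and new edges $av$ for every vertex $v\in V(H)$ with degree at most $2$ in $H$. Then every graph with minimum degree at least $|V(H^* )|-1$ contains a subdivision of $H^*$.
   Context: All graphs are finite, nonempty and simple. A graph is subcubic if every vertex has degree at most 3. A graph contains a subdivision of $F$ if it has a subgraph isomorphic to a graph obtained from $F$ by replacing edges by internally disjoint paths of length at least one with the same ends. For an edge $e=uv$ of a graph $H$, $H/e$ is the graph obtained by contracting $e$ and deleting resulting loops and parallel edges. $[t]=\{1,\dots,t\}$. An ordering of a graph $H$ on $t$ vertices is a sequence $\omega=(\omega_1,\dots,\omega_t)$ listing each vertex of $H$ exactly once; for $S\subseteq[t]$, $\omega_S=\{\omega_s:s\in S\}$. The ordering is recursive if for all $s\in[t-1]$, $\omega_{s+1}$ is adjacent to at most two vertices in $\omega_{[s]}$, and if it is adjacent to exactly two vertices in $\omega_{[s]}$, then these two vertices are adjacent in $H$. A contractible ordering of $H$ is a nonempty set $\Omega$ of recursive orderings of $H$ such that for every $\omega\in\Omega$ and $s\in[t-1]$, if $\omega_{s+1}$ is adjacent to two vertices in $\omega_{[s]}$, say $\omega_i$ and $\omega_j$, then there exists $\omega'\in\Omega$ such that $H[\omega_{[s]}]/\omega_i\omega_j$ is isomorphic to $H[\omega'_{[s-1]}]$. $H$ is contractibly orderable if it admits a contractible ordering. *)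

(* Defs.v *)
From HB Require Import structures.
From mathcomp Require Import all_boot.

Set Implicit Arguments.
Unset Strict Implicit.
Unset Printing Implicit Defensive.

(* Finite simple graphs with vertex set [V]; nonemptiness of [V] is a separate
   hypothesis wherever it is needed. *)
Record sgraph (V : finType) := SGraph {
  adj :> rel V;
  adj_sym : symmetric adj;
  adj_irrefl : irreflexive adj
}.

Definition degree (V : finType) (H : sgraph V) (x : V) : nat :=
  #|[set y | H x y]|.

Definition subcubic (V : finType) (H : sgraph V) : Prop :=
  forall x, degree H x <= 3.

Definition spanning_subgraph (V : finType) (H K : sgraph V) : Prop :=
  subrel H K.

Definition isomorphic (V W : finType) (H : sgraph V) (K : sgraph W) : Prop :=
  exists2 f : V -> W, bijective f & forall x y, K (f x) (f y) = H x y.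

(* [H] is isomorphic to a (not necessarily induced) subgraph of [G]. *)
Definition embeds (V W : finType) (H : sgraph V) (G : sgraph W) : Prop :=
  exists2 f : V -> W, injective f & forall x y, H x y -> G (f x) (f y).

Section Induced.
Variables (V : finType) (H : sgraph V) (A : {set V}).

Definition induced_adj : rel {x : V | x \in A} :=
  fun x y => H (val x) (val y).

Fact induced_sym : symmetric induced_adj.
Proof. by move=> x y; apply: adj_sym. Qed.

Fact induced_irrefl : irreflexive induced_adj.
Proof. by move=> x; apply: adj_irrefl. Qed.

Definition induced : sgraph {x : V | x \in A} :=
  SGraph induced_sym induced_irrefl.

End Induced.

(* The contraction H/uv, meaningful when [u] and [v] are adjacent: [None] is the
   vertex that replaces [u] and [v]. *)
Section Contract.
Variables (V : finType) (H : sgraph V) (u v : V).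

Definition contract_adj : rel (option {x : V | x \notin [set u; v]}) :=
  fun a b => match a, b with
  | Some x, Some y => H (val x) (val y)
  | Some x, None | None, Some x => H (val x) u || H (val x) v
  | None, None => false
  end.

Fact contract_sym : symmetric contract_adj.
Proof. by case=> [x|] [y|] //=; apply: adj_sym. Qed.

Fact contract_irrefl : irreflexive contract_adj.
Proof. by case=> [x|] //=; apply: adj_irrefl. Qed.

Definition contract : sgraph (option {x : V | x \notin [set u; v]}) :=
  SGraph contract_sym contract_irrefl.

End Contract.

(* H^*: the new vertex is [None]. *)
Section Star.
Variables (V : finType) (H : sgraph V).

Definition star_adj : rel (option V) :=
  fun a b => match a, b with
  | Some x, Some y => H x y
  | Some x, None | None, Some x => degree H x <= 2
  | None, None => false
  end.

Fact star_sym : symmetric star_adj.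
Proof. by case=> [x|] [y|] //=; apply: adj_sym. Qed.

Fact star_irrefl : irreflexive star_adj.
Proof. by case=> [x|] //=; apply: adj_irrefl. Qed.

Definition star : sgraph (option V) := SGraph star_sym star_irrefl.

End Star.

(* Orderings are duplicate-free tuples of length t = #|V|. Indices start at 0:
   the vertex written omega_(s+1) in 1-based notation is [tnth w s], and the set
   omega_[s] of the first s vertices is [prefix_set w s]. The range s in [t-1]
   becomes [s : 'I_#|V|] with [0 < s]. *)
Definition is_ordering (V : finType) (w : #|V|.-tuple V) : Prop := uniq w.

Definition prefix_set (V : finType) (w : #|V|.-tuple V) (s : nat) : {set V} :=
  [set x in take s w].

Definition back_neighbors (V : finType) (H : sgraph V) (w : #|V|.-tuple V)
    (s : 'I_#|V|) : {set V} :=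
  [set x in prefix_set w s | H (tnth w s) x].

Definition recursive_ordering (V : finType) (H : sgraph V)
    (w : #|V|.-tuple V) : Prop :=
  is_ordering w /\
  forall s : 'I_#|V|, 0 < s ->
    #|back_neighbors H w s| <= 2 /\
    (#|back_neighbors H w s| = 2 ->
     {in back_neighbors H w s &, forall x y, x != y -> H x y}).

Definition contractible_ordering (V : finType) (H : sgraph V)
    (Omega : {set #|V|.-tuple V}) : Prop :=
  [/\ Omega != set0,
      forall w, w \in Omega -> recursive_ordering H w
    & forall w, w \in Omega ->
      forall s : 'I_#|V|, 0 < s ->
      forall x y : {z : V | z \in prefix_set w s}, x != y ->
      H (tnth w s) (val x) -> H (tnth w s) (val y) ->
      exists2 w', w' \in Omega &
        isomorphic (contract (induced H (prefix_set w s)) x y)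
                   (induced H (prefix_set w' (s - 1)))].

Definition contractibly_orderable (V : finType) (H : sgraph V) : Prop :=
  exists Omega : {set #|V|.-tuple V}, contractible_ordering H Omega.

(* [F'] is obtained from [F] by replacing each edge xy by a path from [f x] to
   [f y] whose list of internal vertices is [p x y]. Each edge is seen from both
   ends, hence [p y x = rev (p x y)]; [p x y] is irrelevant if xy is no edge. *)
Record subdivision_via (V U : finType) (F : sgraph V) (F' : sgraph U)
    (f : V -> U) (p : V -> V -> seq U) : Prop := SubdivisionVia {
  subdiv_inj : injective f;
  subdiv_rev : forall x y, F x y -> p y x = rev (p x y);
  subdiv_path : forall x y, F x y -> path F' (f x) (rcons (p x y) (f y));
  subdiv_uniq : forall x y, F x y -> uniq (p x y);
  subdiv_internal : forall x y z, F x y -> f z \notin p x y;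
  subdiv_disjoint : forall x y x' y' u, F x y -> F x' y' ->
    u \in p x y -> u \in p x' y' -> x = x' /\ y = y' \/ x = y' /\ y = x';
  subdiv_vertex : forall u,
    (exists x, u = f x) \/ (exists x y, F x y /\ u \in p x y);
  subdiv_edge : forall u v, F' u v ->
    exists x y, F x y /\ infix [:: u; v] (f x :: rcons (p x y) (f y))
}.

Definition is_subdivision (V U : finType) (F : sgraph V) (F' : sgraph U) :
    Prop :=
  exists (f : V -> U) (p : V -> V -> seq U), subdivision_via F F' f p.

Definition contains_subdivision (W V : finType) (G : sgraph W) (F : sgraph V) :
    Prop :=
  exists (U : finType) (F' : sgraph U), is_subdivision F F' /\ embeds F' G.

(* Main.v *)
Require Import Defs.
From mathcomp Require Import all_boot zify.

Set Implicit Arguments.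
Unset Strict Implicit.
Unset Printing Implicit Defensive.

(* Let t = |V|. Keep disjoint connected parts of G forming a model of the first
   s vertices of an ordering of K, together with a set C of unused vertices,
   such that after contracting the parts every vertex of C keeps degree at
   least t, and no nonempty subset of C is separated from the parts by fewer
   than s vertices. While s < t, consider the next vertex of the ordering.
   If a vertex of C touches the parts of all its earlier neighbours, then make
   it a new part. If this creates a separator of order s, that separator has
   the same order as the old model, so by a Menger argument the model can be
   grown up to it, and C shrinks without s changing. Otherwise the next vertex
   has two earlier neighbours whose parts have no common neighbour in C;
   merging these parts lowers no degree in C, and the contractible ordering
   provides an ordering for the merged model. The pair (|C|, s) decreases, so
   finally s = t, and Menger links every part to one vertex a of C. Vertices
   of H^* other than the new one have degree at most 3, so this model, in which
   the part of the new vertex is {a}, contains a subdivision of H^*. *)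

(** * Linkages between connected parts *)

Lemma leq_cardsD1 (T : finType) (A : {set T}) x n : n < #|A| -> n <= #|A :\ x|.
Proof.
rewrite (cardsD1 x A); case: (x \in A); first by rewrite add1n ltnS.
exact: ltnW.
Qed.

Section Packings.
Variables (W : finType) (G : sgraph W).
Implicit Types (A B C D E F : {set W}).

Definition touches A B := [exists x in A, exists y in B, G x y].

Lemma touchesP A B :
  reflect (exists x y, [/\ x \in A, y \in B & G x y]) (touches A B).
Proof.
apply: (iffP existsP) => [[x /andP[xA /existsP[y /andP[yB xy]]]]|[x [y [xA yB xy]]]].
  by exists x, y.
by exists x; rewrite xA; apply/existsP; exists y; rewrite yB.
Qed.

Lemma touchesC A B : touches A B = touches B A.
Proof.
by apply/touchesP/touchesP => -[x [y [xA yB xy]]]; exists y, x; rewrite adj_sym.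
Qed.

Lemma touchesS A A' B B' :
  A \subset A' -> B \subset B' -> touches A B -> touches A' B'.
Proof.
move=> /subsetP AA' /subsetP BB' /touchesP[x [y [xA yB xy]]].
by apply/touchesP; exists x, y; rewrite AA' ?BB'.
Qed.

Lemma touchesUl A A' B : touches (A :|: A') B = touches A B || touches A' B.
Proof.
apply/idP/orP => [/touchesP[x [y [/setUP[]xA yB xy]]]|[]].
- by left; apply/touchesP; exists x, y.
- by right; apply/touchesP; exists x, y.
- by apply: touchesS; rewrite ?subsetUl.
- by apply: touchesS; rewrite ?subsetUr.
Qed.

Lemma touchesUr A B B' : touches A (B :|: B') = touches A B || touches A B'.
Proof. by rewrite touchesC touchesUl !(touchesC _ A). Qed.

Definition inner A : rel W := [rel x y | [&& x \in A, y \in A & G x y]].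

Definition connected A :=
  A != set0 /\ {in A &, forall x y, connect (inner A) x y}.

Lemma connected1 x : connected [set x].
Proof.
split; first by apply/set0Pn; exists x; rewrite inE.
by move=> y z /set1P-> /set1P->; apply: connect0.
Qed.

Lemma connect_innerS A A' x y :
  A \subset A' -> connect (inner A) x y -> connect (inner A') x y.
Proof.
move=> /subsetP sAA'; apply: connect_sub => u v /and3P[uA vA uv].
by apply: connect1; rewrite /inner /= !sAA'.
Qed.

Lemma connect_inner_sym A : connect_sym (inner A).
Proof.
by apply: sym_connect_sym => x y; rewrite /inner /= adj_sym andbCA.
Qed.

Lemma connectedU A B :
  connected A -> connected B -> touches A B -> connected (A :|: B).
Proof.
move=> [A0 cA] [_ cB] /touchesP[a [b [aA bB ab]]]; split.
  by apply/set0Pn; exists a; rewrite inE aA.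
have to_a x : x \in A :|: B -> connect (inner (A :|: B)) x a.
  case/setUP=> [xA|xB].
    by apply: connect_innerS (cA _ _ xA aA); apply: subsetUl.
  apply: (connect_trans (connect_innerS (subsetUr A B) (cB _ _ xB bB))).
  by apply: connect1; rewrite /inner /= !inE aA bB orbT adj_sym.
move=> x y xAB yAB; apply: connect_trans (to_a x xAB) _.
by rewrite connect_inner_sym to_a.
Qed.

Section Family.
Variable I : finType.
Implicit Type P : I -> {set W}.

Record packing P C : Prop := Packing {
  packing_connected : forall i, connected (P i);
  packing_inj : forall i j x, x \in P i -> x \in P j -> i = j;
  packing_off : forall i x, x \in P i -> x \notin C
}.

(* The neighbourhood of [E] in the graph obtained from [G] by contracting every
   part [P i] to a vertex and deleting what lies outside [C] and the parts. *)
Definition boundary P C E : {set W + I} :=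
  [set z | match z with
           | inl y => (y \in C :\: E) && touches E [set y]
           | inr i => touches E (P i)
           end].

(** The boundary of all of [C] contains no vertex of [C], only parts, so having [#|I|] elements
    forces it to contain every part. *)
Lemma boundary_full P C :
  #|I| <= #|boundary P C C| -> forall i, touches C (P i).
Proof.
have sub : boundary P C C \subset (@inr W I) @: [set j | touches C (P j)].
  apply/subsetP=> -[y|j]; rewrite inE; first by rewrite setDv inE.
  by move=> jC; apply: imset_f; rewrite inE.
move=> leI i; have := leq_trans leI (subset_leq_card sub).
rewrite card_imset; last by move=> ? ? [].
rewrite -cardsT => leT.
have /eqP eT : [set j | touches C (P j)] == [set: I] by rewrite eqEcard subsetT.
by have : i \in [set: I] by []; rewrite -eT inE.
Qed.

(* If [boundary P C E] is tight, then every [P' i] contains exactly one of its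
   elements, so contracting [P'] instead of [P] identifies none of them. *)
Lemma boundary_tight P P' C E F :
  packing P' E -> #|boundary P C E| = #|I| ->
  (forall i, P i \subset P' i) ->
  (forall i, P' i \subset P i :|: (C :\: E)) ->
  (forall i, touches E (P' i)) -> F \subset E ->
  #|boundary P C F| <= #|boundary P' E F|.
Proof.
move=> packP' tight PP' P'sub P'E FE.
(* [g i] is the boundary element met by [P' i]: the part [i] itself when [E] touches [P i],
   otherwise a vertex that [P' i] gained in [C :\: E]. It is injective because the parts are
   disjoint, and by tightness its image is the whole boundary. *)
have [g gP] : exists g : I -> W + I, forall i, g i \in boundary P C E /\
    (g i = inr i \/ exists2 y, g i = inl y & y \in P' i).
  apply: (fin_all_exists (P := fun i z => z \in boundary P C E /\
    (z = inr i \/ exists2 y, z = inl y & y \in P' i))) => i.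
  have [PiE|PiE] := boolP (touches E (P i)).
    by exists (inr i); rewrite inE PiE; split=> //; left.
  have /touchesP[x [y [xE yP' xy]]] := P'E i.
  exists (inl y); rewrite inE; split; last by right; exists y.
  have := subsetP (P'sub i) y yP'; rewrite in_setU => /orP[yP|->] /=.
    by case/negP: PiE; apply/touchesP; exists x, y.
  by apply/touchesP; exists x, y; rewrite inE.
have g_inj : injective g.
  move=> i j gij; have [_ gi] := gP i; have [_ gj] := gP j.
  case: gi gj => [gi|[y gi yi]] [gj|[z gj zj]].
  - by move: gij; rewrite gi gj => -[].
  - by move: gij; rewrite gi gj.
  - by move: gij; rewrite gi gj.
  - move: gij; rewrite gi gj => -[yz].
    by apply: (packing_inj packP' yi); rewrite yz.
have imgE : g @: [set: I] = boundary P C E.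
  apply/eqP; rewrite eqEcard card_imset // cardsT tight leqnn andbT.
  by apply/subsetP => _ /imsetP[i _ ->]; case: (gP i).
pose keep (z : W + I) := if z is inl y then y \in E else false.
(* Elements of [boundary P C F] inside [E] stay. Any other one lies in [boundary P C E], hence is
   some [g i], and is sent to the part [P' i] that contains or extends it. *)
pose h z := if keep z then z else if [pick i | g i == z] is Some i then inr i else z.
have hP z : z \in boundary P C F ->
  (keep z /\ h z = z) \/ exists i, [/\ ~~ keep z, g i = z & h z = inr i].
  rewrite /h => zF; case kz: (keep z); first by left.
  have zE : z \in boundary P C E.
    case: z zF kz => [y|i]; rewrite !inE /=.
      case/andP=> /andP[_ ->] yF -> /=.
      by apply: touchesS yF.
    by move=> iF _; apply: touchesS iF.
  move: zE; rewrite -imgE => /imsetP[i _ zi]; right.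
  case: pickP => [j /eqP gj|/(_ i)]; last by rewrite zi eqxx.
  by exists j.
have h_inj : {in boundary P C F &, injective h}.
  move=> z z' /hP[[kz ->]|[i [kz gi ->]]] /hP[[kz' ->]|[j [kz' gj ->]]] //.
  - by move=> zj; move: kz; rewrite zj.
  - by move=> zj; move: kz'; rewrite -zj.
  - by case=> ij; rewrite -gi -gj ij.
rewrite -(card_in_imset h_inj); apply/subset_leq_card/subsetP.
move=> _ /imsetP[z zF ->]; case: (hP z zF) => [[kz ->]|[i [kz gi ->]]].
  case: z kz zF => // y /= yE; rewrite !inE yE => /andP[/andP[-> _] ->] //.
rewrite inE; case: (gP i) => _ [gi'|[y gi' yi]].
  by move: zF; rewrite -gi gi' inE; apply: touchesS.
move: zF; rewrite -gi gi' inE => /andP[_]; apply: touchesS => //.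
by rewrite sub1set.
Qed.

(* Menger's theorem between [D] and the parts. A tight set strictly between [D]
   and [C] splits the problem in two; without one, a vertex of [C :\: D] can be
   either deleted from [C] or absorbed into a part. *)
Lemma linking P C D :
  packing P C -> D \subset C ->
  (forall E, D \subset E -> E \subset C -> #|I| <= #|boundary P C E|) ->
  exists P', [/\ packing P' D, forall i, P i \subset P' i,
    forall i, P' i \subset P i :|: (C :\: D) & forall i, touches D (P' i)].
Proof.
have [n] := ubnP #|C :\: D|; elim: n P C D => // n IHn P C D lt_n packP DC large.
(* At a tight [E], link the parts to [E] inside [C], then the grown parts to [D] inside [E];
   [boundary_tight] transfers the hypothesis to the second problem. *)
have [/existsP[E /and3P[DE EC /eqP tight]]|noE] :=
  boolP [exists E : {set W}, [&& D \proper E, E \proper C &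
                              #|boundary P C E| == #|I|]].
  have [sDE sEC] := (proper_sub DE, proper_sub EC).
  have lt1 : #|C :\: E| < n.
    rewrite -ltnS; apply: leq_trans lt_n; rewrite ltnS.
    apply: proper_card; rewrite properE setDS //=.
    case/properP: DE => _ [x xE xD]; apply/subsetPn; exists x; rewrite !inE ?xD ?xE //.
    by rewrite (subsetP sEC).
  have lt2 : #|E :\: D| < n.
    rewrite -ltnS; apply: leq_trans lt_n; rewrite ltnS.
    apply: proper_card; rewrite properE setSD //=.
    case/properP: EC => _ [x xC xE]; apply/subsetPn; exists x; rewrite !inE ?xC ?(negPf xE) ?andbF //.
    by rewrite andbT; apply: contra xE; apply: (subsetP sDE).
  have [|P1 [pack1 PP1 P1P P1E]] := IHn P C E lt1 packP sEC.
    by move=> F EF FC; apply: large => //; apply: subset_trans EF.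
  have [|P2 [pack2 PP2 P2P P2D]] := IHn P1 E D lt2 pack1 sDE.
    move=> F DF FE; apply: leq_trans (boundary_tight pack1 tight PP1 P1P P1E FE).
    by apply: large => //; apply: subset_trans FE _.
  exists P2; split=> // i; first exact: subset_trans (PP1 i) (PP2 i).
  apply: subset_trans (P2P i) _; rewrite subUset; apply/andP; split.
    apply: subset_trans (P1P i) _; apply: setUS; exact: setDS.
  by apply: subset_trans (subsetUr _ _); apply: setSD.
(* Without a tight set strictly between, every [E] other than [D] has one boundary element to spare,
   which pays for removing [u] from [C]. *)
have loose u E : u \in C -> u \notin E -> D \subset E -> E \subset C -> E != D ->
    #|I| < #|boundary P C E|.
  move=> uC uE DE EC ED; rewrite ltn_neqAle large // andbT eq_sym.
  move: noE; rewrite negb_exists => /forallP/(_ E).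
  rewrite !properEneq DE EC eq_sym ED /= andbT => /nandP[/negPn/eqP EC'|//].
  by move: uC; rewrite -EC' (negPf uE).
have [CD|/subsetPn[u0 u0C u0D]] := boolP (C \subset D).
  have eCD : C = D by apply/eqP; rewrite eqEsubset CD.
  exists P; split=> // [|i|i]; [by rewrite -eCD | exact: subsetUl |].
  by rewrite -eCD; apply: boundary_full; rewrite {2}eCD; apply: large.
have lt_u u : u \in C -> u \notin D -> #|(C :\ u) :\: D| < n.
  move=> uC uD; rewrite -ltnS; apply: leq_trans lt_n; rewrite ltnS.
  apply: proper_card; rewrite properE setSD ?subD1set //=.
  by apply/subsetPn; exists u; rewrite !inE ?uC ?uD // eqxx andbF.
have subD1 u : u \in C -> u \notin D -> D \subset C :\ u.
  by move=> uC uD; rewrite subsetD1 DC.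
have bd_u u E : boundary P C E :\ inl u \subset boundary P (C :\ u) E.
  apply/subsetP=> -[y|i]; rewrite !inE // => /andP[yu /andP[/andP[-> ->] ->]].
  by rewrite !andbT; apply: contraNneq yu => ->.
(* A vertex [u] can be deleted if this leaves the boundary of [D] large enough: either [u] is not in
   it, or it has an element to spare. *)
have [/existsP[u /and3P[uC uD good]]|noU] := boolP [exists u, [&& u \in C,
    u \notin D & ~~ touches D [set u] || (#|I| < #|boundary P C D|)]].
  have [||P' [pack' PP' P'P P'D]] := IHn P (C :\ u) D (lt_u u uC uD) _ (subD1 u uC uD).
  - split; [exact: packing_connected packP | exact: packing_inj packP |].
    by move=> i x xP; rewrite inE (negPf (packing_off packP xP)) andbF.
  - move=> E DE; rewrite subsetD1 => /andP[EC uE].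
    apply: leq_trans (subset_leq_card (bd_u u E)).
    have [->|ED] := eqVneq E D; last exact/leq_cardsD1/(loose u).
    case/orP: good => [uD'|ltD]; last exact: leq_cardsD1.
    have := cardsD1 (inl u) (boundary P C D).
    rewrite inE (negPf uD') andbF add0n => <-; exact: large.
  exists P'; split=> // i; apply: subset_trans (P'P i) _.
  by apply: setUS; apply: setSD; apply: subD1set.
have allD y : y \in C -> y \notin D -> touches D [set y].
  move=> yC yD; move: noU; rewrite negb_exists => /forallP/(_ y).
  by rewrite yC yD negb_or negbK => /andP[].
have tightD : #|boundary P C D| = #|I|.
  apply/eqP; rewrite eqn_leq large // andbT leqNgt.
  move: noU; rewrite negb_exists => /forallP/(_ u0).
  by rewrite u0C u0D negb_or => /andP[].
pose u := u0.
have cardD : #|boundary P C D| = (#|boundary P C D :\ inl u|).+1.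
  by rewrite (cardsD1 (inl u)) !inE u0D u0C allD.
(* Now [D] is tight and adjacent to all of [C :\: D]. If every part touching [u] also touched [D],
   moving [u] into [D] would remove [u] from the boundary and add nothing, leaving fewer than [#|I|]
   elements. *)
have [x ux xD] : exists2 x, touches [set u] (P x) & ~~ touches D (P x).
  suff /existsP[x /andP[]] : [exists x, touches [set u] (P x) && ~~ touches D (P x)].
    by exists x.
  apply: contraT; rewrite negb_exists => /forallP no_x.
  have sub : boundary P C (u |: D) \subset boundary P C D :\ inl u.
    apply/subsetP=> -[y|j]; rewrite !inE.
      case/andP=> /andP[]; rewrite negb_or => /andP[yu yD] yC _.
      by rewrite yD yC allD // !andbT; apply: contraNneq yu => -[->].
    rewrite touchesUl => /orP[uj|//].
    by have := no_x j; rewrite uj negbK.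
  have := leq_trans (large (u |: D) _ _) (subset_leq_card sub).
  rewrite subsetUr subUset sub1set u0C DC -tightD cardD => /(_ isT isT).
  by rewrite ltnn.
(* Absorbing [u] into the part [x] exchanges [u] for [x] in the boundary of [D], so its size is
   unchanged. *)
pose P1 i := if i == x then u |: P x else P i.
have PP1 i : P i \subset P1 i.
  by rewrite /P1; case: eqP => [->|_] //; apply: subsetUr.
have uP i : u \notin P i by apply: contraL u0C => /(packing_off packP).
have P1P i y : y \in P1 i -> y \in P i \/ y = u /\ i = x.
  rewrite /P1; case: eqP => [->|_]; last by left.
  by case/setU1P; [right | left].
have pack1 : packing P1 (C :\ u).
  split=> [i|i j y /P1P[yi|[-> ->]] /P1P[yj|[yu ->]]|i y /P1P[yi|[-> _]]] //.
  - rewrite /P1; case: eqP => _; last exact: packing_connected packP i.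
    by apply: connectedU ux; [apply: connected1 | apply: packing_connected packP x].
  - exact: (packing_inj packP yi yj).
  - by move: yi; rewrite yu (negPf (uP i)).
  - by move: yj; rewrite (negPf (uP j)).
  - by rewrite inE (negPf (packing_off packP yi)) andbF.
  - by rewrite !inE eqxx.
have [|P' [pack' P1P' P'P P'D]] := IHn P1 (C :\ u) D (lt_u u u0C u0D) pack1 (subD1 u u0C u0D).
  move=> E DE; rewrite subsetD1 => /andP[EC uE].
  have sub1 : boundary P C E :\ inl u \subset boundary P1 (C :\ u) E.
    apply: subset_trans (bd_u u E) _; apply/subsetP=> -[y|i]; rewrite !inE //.
    by apply: touchesS.
  have [ED|ED] := eqVneq E D; last first.
    apply: leq_trans (subset_leq_card sub1).
    exact/leq_cardsD1/(loose u).
  have sub2 : inr x |: (boundary P C D :\ inl u) \subset boundary P1 (C :\ u) E.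
    rewrite subUset -{1}ED sub1 andbT sub1set inE /P1 eqxx touchesUr ED.
    by rewrite (allD u).
  apply: leq_trans (subset_leq_card sub2).
  by rewrite cardsU1 !inE (negPf xD) /= add1n -tightD cardD.
exists P'; split=> // i; first exact: subset_trans (PP1 i) (P1P' i).
apply/subsetP=> y /(subsetP (P'P i)); rewrite in_setU => /orP[/P1P[yi|[-> _]]|].
- by rewrite inE yi.
- by rewrite !inE u0C u0D orbT.
- by rewrite !inE => /and3P[-> _ ->]; rewrite orbT.
Qed.

End Family.
End Packings.

(** * Growing a model along a contractible ordering *)

Section States.
Variables (W : finType) (G : sgraph W) (t : nat).

(** The boundary of [[set c]] counts the neighbours of [c] after contraction, so [state_degree] is a
    minimum degree condition; [state_linked] is the Menger condition required by [linking]. *)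
Record state (I : finType) (r : rel I) (P : I -> {set W}) (C : {set W}) : Prop :=
  State {
  state_packing : packing G P C;
  state_adj : forall i j, r i j -> touches G (P i) (P j);
  state_degree : forall c, c \in C -> t <= #|boundary G P C [set c]|;
  state_linked : forall E : {set W}, E \subset C -> E != set0 ->
    #|I| <= #|boundary G P C E|;
  state_nonempty : C != set0
}.

Lemma state_reindex (I J : finType) (r : rel I) (r' : rel J) (h : J -> I) P C :
  bijective h -> (forall x y, r' x y -> r (h x) (h y)) ->
  state r P C -> state r' (P \o h) C.
Proof.
move=> bij_h hr [[conP injP offP] adjP degP linkP C0].
have bdh E : #|boundary G P C E| <= #|boundary G (P \o h) C E|.
  case: bij_h => g hK gK.
  pose k (z : W + I) := match z with inl y => inl y | inr i => inr (g i) end.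
  have k_inj : injective k.
    by move=> [y|i] [z|j] //= [] => [->|/(can_inj gK) ->].
  rewrite -(card_imset _ k_inj); apply/subset_leq_card/subsetP.
  by move=> _ /imsetP[[y|i] zE ->]; move: zE; rewrite !inE /comp /= ?gK ?inE.
split=> // [|x y /hr/adjP|c cC|E EC E0] //.
- split=> [i|i j x xi xj|i x xi]; [exact: conP | | exact: offP xi].
  exact/(bij_inj bij_h)/(injP _ _ x).
- exact: leq_trans (degP c cC) _.
- by rewrite (bij_eq_card bij_h); apply: leq_trans (linkP E EC E0) _.
Qed.

Section Step.
Variables (I : finType) (r : rel I) (P : I -> {set W}) (C : {set W}).
Hypothesis st : state r P C.

(** [linking] grows the parts up to the tight set [E]; [boundary_tight] then shows that subsets of
    [E] lose no boundary, which preserves both degrees and linkage. *)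
Lemma state_push (E : {set W}) :
  E \subset C -> E != set0 -> #|boundary G P C E| = #|I| ->
  exists P', state r P' E.
Proof.
move=> EC E0 tight; case: st => packP adjP degP linkP C0.
have [|P' [packP' PP' P'P P'E]] := linking packP EC.
  move=> F EF FC; apply: linkP => //.
  by apply: contraNneq E0 => F0; rewrite -subset0 -F0.
have bdle F := boundary_tight packP' tight PP' P'P P'E (F := F).
exists P'; split=> // [i j /adjP|c cE|F FE F0].
- exact: touchesS.
- apply: leq_trans (bdle _ _); last by rewrite sub1set.
  by apply: degP; apply: (subsetP EC).
- by apply: leq_trans (bdle _ FE); apply: linkP => //; apply: subset_trans EC.
Qed.

Definition extend_rel (N : pred I) : rel (option I) :=
  fun a b => match a, b with
             | Some i, Some j => r i j
             | Some i, None | None, Some i => N i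
             | None, None => false
             end.

(** With [[set w]] as a new part only linkage can fail, since there is one more part to separate. A
    set [E] violating it is tight for the old parts, so [state_push] applies to it. *)
Lemma state_extend (N : pred I) w :
  #|I| < t -> w \in C -> (forall i, N i -> touches G [set w] (P i)) ->
  (exists P', state (extend_rel N) P' (C :\ w)) \/
  exists (E : {set W}) P', E \subset C :\ w /\ state r P' E.
Proof.
move=> lt_t wC NP; case: (st) => -[conP injP offP] adjP degP linkP C0.
pose P' a := if a is Some i then P i else [set w].
have bdle (E : {set W}) : E \subset C :\ w ->
    #|boundary G P C E| <= #|boundary G P' (C :\ w) E|.
  move=> EC.
  (* The vertex [w] survives in boundaries as the new part [None]. *)
  pose k (z : W + I) : W + option I :=
    match z with
    | inl y => if y == w then inr None else inl y
    | inr i => inr (Some i) end.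
  have k_inj : injective k.
    move=> [y|i] [z|j] //=; last by move=> [->].
    - by have [->|_] := eqVneq y w; have [->|_] := eqVneq z w => // -[->].
    - by case: eqP.
    - by case: eqP.
  rewrite -(card_imset _ k_inj); apply/subset_leq_card/subsetP.
  move=> _ /imsetP[[y|i] zE ->]; move: zE; rewrite !inE //=.
  case: eqP => [->|/eqP yw]; first by rewrite /= => /andP[].
  by rewrite !inE yw.
have [/existsP[E /and3P[EC E0 lt_bd]]|noE] := boolP [exists E : {set W},
    [&& E \subset C :\ w, E != set0 & #|boundary G P' (C :\ w) E| <= #|I|]].
  have EC' : E \subset C by apply: subset_trans EC (subD1set _ _).
  have [|P1 st1] := state_push EC' E0; last by right; exists E, P1.
  apply/eqP; rewrite eqn_leq linkP // andbT.
  exact: leq_trans (bdle _ EC) lt_bd.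
left; exists P'; split.
- split.
  + by case=> [i|]; [apply: conP | apply: connected1].
  + move=> [i|] [j|] x //= => [xi xj|xi|/set1P-> wj].
    * by rewrite (injP _ _ _ xi xj).
    * by move=> /set1P xw; move: wC; rewrite -xw (negPf (offP _ _ xi)).
    * by move: wC; rewrite (negPf (offP _ _ wj)).
  + move=> [i|] x /=; last by move=> /set1P->; rewrite !inE eqxx.
    by move=> /offP xC; rewrite inE (negPf xC) andbF.
- move=> [i|] [j|] //=; [exact: adjP | by rewrite touchesC; apply: NP | exact: NP].
- move=> c cC; apply: leq_trans (bdle _ _); last by rewrite sub1set.
  by apply: degP; move: cC; rewrite inE => /andP[].
- move=> E EC E0; rewrite card_option ltnNge; apply: contra noE => le_bd.
  by apply/existsP; exists E; rewrite EC E0.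
(* If [w] were the only vertex of [C], its neighbours would all be parts, fewer than [t] of them. *)
- apply: contraTneq (degP w wC) => Cw0; rewrite -ltnNge.
  apply: leq_ltn_trans lt_t.
  have sub : boundary G P C [set w] \subset (@inr W I) @: [set: I].
    by apply/subsetP=> -[y|i]; rewrite inE ?Cw0 ?inE // => _; apply: imset_f.
  by apply: leq_trans (subset_leq_card sub) (leq_trans (leq_imset_card _ _) _); rewrite cardsT.
Qed.

End Step.

(** Merging costs a boundary at most one element, and there is one part fewer, so linkage persists.
    The boundary of a single vertex loses nothing, since no vertex of [C] touches both merged
    parts. *)
Lemma state_contract (I : finType) (F : sgraph I) P C u v :
  state F P C -> F u v ->
  (forall c, c \in C -> touches G [set c] (P u) -> ~~ touches G [set c] (P v)) ->
  exists P', state (contract F u v) P' C.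
Proof.
move=> [[conP injP offP] adjP degP linkP C0] uv no_common.
have uDv : u != v by apply: contraTneq uv => ->; rewrite adj_irrefl.
pose X := {x : I | x \notin [set u; v]}; pose J := option X.
pose P' (a : J) := if a is Some i then P (val i) else P u :|: P v.
(* [insub] sends exactly [u] and [v] to [None], the merged part, so these are the only elements that
   [k] identifies. *)
pose k (z : W + I) : W + J :=
  match z with inl y => inl y | inr i => inr (insub i) end.
have kP E z : z \in boundary G P C E -> k z \in boundary G P' C E.
  case: z => [y|i]; rewrite !inE //=.
    by rewrite inE.
  case: (insubP X i) => /= [x _ -> //|].
  rewrite negbK !inE touchesUr => /orP[]/eqP-> ->//; exact: orbT.
have k_inj (A : {set W + I}) : (inr u \notin A) || (inr v \notin A) -> {in A &, injective k}.
  move=> uvA [y|i] [z|j] //= => [_ _ [->]//|iA jA [ij]].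
  move: ij; case: (insubP X i) => [x _ <-|]; case: (insubP X j) => [x' _ <-|] //.
    by move=> [->].
  rewrite !negbK !inE => /orP[]/eqP jE /orP[]/eqP iE _; rewrite iE jE // in iA jA *;
    by move: uvA; rewrite iA jA.
have bdle E : #|boundary G P C E| <= #|boundary G P' C E|.+1.
  rewrite (cardsD1 (inr u)) -add1n leq_add ?leq_b1 //.
  rewrite -(card_in_imset (k_inj _ _)); last by rewrite !inE eqxx.
  apply/subset_leq_card/subsetP=> _ /imsetP[z zE ->]; apply: kP.
  by move: zE; rewrite inE => /andP[].
exists P'; split=> //.
- split.
  + by case=> [i|] //=; apply: connectedU => //; apply: adjP.
  + have uvN (x : {x : I | x \notin [set u; v]}) y : y \in P (val x) -> y \in P u :|: P v -> False.
      move=> yx /setUP[yu|yv]; have := valP x; rewrite !inE.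
        by rewrite (injP _ _ _ yx yu) eqxx.
      by rewrite (injP _ _ _ yx yv) eqxx orbT.
    move=> [i|] [j|] y //= yi yj; [|by case: (uvN i y)|by case: (uvN j y)].
    by congr Some; apply: val_inj; apply: injP yi yj.
  + by move=> [i|] y /=; [apply: offP | case/setUP; apply: offP].
- move=> [i|] [j|] //=; first exact: adjP.
    by case/orP=> /adjP; rewrite touchesUr => ->; rewrite ?orbT.
  by case/orP=> /adjP; rewrite touchesC touchesUl => ->; rewrite ?orbT.
- move=> c cC; apply: leq_trans (degP c cC) _.
  rewrite -(card_in_imset (k_inj _ _)).
    by apply/subset_leq_card/subsetP=> _ /imsetP[z zE ->]; apply: kP.
  by rewrite !inE -implybE; apply/implyP; apply: no_common.
- move=> E EC E0; rewrite -ltnS; apply: leq_trans (bdle E).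
  apply: leq_trans (linkP E EC E0); rewrite card_option card_sig.
  have := cardC [set u; v]; rewrite cards2 uDv => <-.
  by rewrite add2n !ltnS; apply/eq_leq/eq_card => x; rewrite !inE.
Qed.

End States.

Lemma state_rooted (W : finType) (G : sgraph W) t (I : finType) (r : rel I) P C :
  state G t r P C -> exists a P', [/\ packing G P' [set a],
    forall i j, r i j -> touches G (P' i) (P' j) &
    forall i, touches G [set a] (P' i)].
Proof.
move=> [packP adjP _ linkP /set0Pn[a aC]]; exists a.
have [||P' [packP' PP' _ P'a]] := linking (D := [set a]) packP.
- by rewrite sub1set.
- move=> E aE EC; apply: linkP => //; apply/set0Pn; exists a.
  by rewrite (subsetP aE) ?set11.
by exists P'; split=> // i j /adjP; apply: touchesS.
Qed.

Section Orderings.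
Variables (V W : finType) (K : sgraph V) (G : sgraph W).
Implicit Type w : #|V|.-tuple V.

Lemma card_prefix w s :
  uniq w -> s <= #|V| -> #|{: {x : V | x \in prefix_set w s}}| = s.
Proof.
move=> uw les; rewrite card_sig (eq_card (B := mem (take s w))).
  by rewrite (card_uniqP (take_uniq s uw)) size_take size_tuple; case: ltngtP les.
by move=> x; rewrite !inE.
Qed.

Lemma prefix_setS w (s : 'I_#|V|) : prefix_set w s.+1 = tnth w s |: prefix_set w s.
Proof.
apply/setP=> x; rewrite !inE (take_nth x) ?size_tuple // mem_rcons inE.
by rewrite -tnth_nth.
Qed.

Lemma state_next w (s : 'I_#|V|) P C :
  uniq w ->
  state G #|V| (extend_rel (induced K (prefix_set w s))
                  (fun i => K (tnth w s) (val i))) P C ->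
  exists P', state G #|V| (induced K (prefix_set w s.+1)) P' C.
Proof.
move=> uw; set v := tnth w s => st.
pose I := {x : V | x \in prefix_set w s}.
pose h (z : {x : V | x \in prefix_set w s.+1}) : option I := insub (val z).
have hP z : (exists2 i, h z = Some i & val i = val z) \/ h z = None /\ val z = v.
  rewrite /h; case: (insubP I (val z)) => [i _ iz|zN]; first by left; exists i.
  right; split=> //; have : val z \in v |: prefix_set w s.
    by rewrite -prefix_setS; apply: valP z.
  by rewrite in_setU1 (negPf zN) orbF => /eqP.
exists (P \o h); apply: state_reindex st.
- apply: inj_card_bij.
    move=> x y; case: (hP x) (hP y) => [[i -> ix]|[-> xv]] [[j -> jy]|[-> yv]] //.
      by case=> ij; apply: val_inj; rewrite -ix -jy ij.
    by move=> _; apply: val_inj; rewrite xv yv.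
  by rewrite card_option !card_prefix // ltnW.
- move=> x y; rewrite /= /induced_adj.
  case: (hP x) (hP y) => [[i -> <-]|[-> ->]] [[j -> <-]|[-> ->]] //=.
    by rewrite adj_sym.
  by rewrite adj_irrefl.
Qed.

Lemma state_end w P C :
  uniq w -> state G #|V| (induced K (prefix_set w #|V|)) P C ->
  exists P', state G #|V| K P' C.
Proof.
move=> uw st; pose I := {x : V | x \in prefix_set w #|V|}.
have wP x : x \in prefix_set w #|V|.
  suff /eqP-> : prefix_set w #|V| == [set: V] by [].
  rewrite eqEcard subsetT cardsT -[X in X <= _](card_prefix uw (leqnn _)).
  by rewrite card_sig; apply/eq_leq/eq_card => y; rewrite !inE.
pose h x : I := Sub x (wP x).
exists (P \o h); apply: state_reindex st => //.
by exists val => [x|i]; [|apply: val_inj].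
Qed.

Lemma ordering_rooted (Omega : {set #|V|.-tuple V}) w s P C :
  contractible_ordering K Omega -> w \in Omega -> s <= #|V| ->
  state G #|V| (induced K (prefix_set w s)) P C ->
  exists a P', [/\ packing G P' [set a],
    forall x y, K x y -> touches G (P' x) (P' y) &
    forall x, touches G [set a] (P' x)].
Proof.
move=> [_ recO conO].
(* Since [s <= #|V|], this weight encodes the lexicographic order on [(#|C|, s)]. *)
have [n] := ubnP (#|C| * #|V|.+1 + s).
elim: n w s P C => // n IHn w s P C lt_n wO le_s st.
have [uw rec_w] := recO w wO.
move: le_s; rewrite leq_eqVlt => /predU1P[s_max|lt_s].
  have [P' st'] : exists P', state G #|V| K P' C.
    by move: P st; rewrite s_max => P; apply: state_end.
  exact: state_rooted st'.
pose so := Ordinal lt_s; pose v := tnth w so.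
pose I := {x : V | x \in prefix_set w s}.
have cardI : #|{: I}| = s by apply: card_prefix uw (ltnW lt_s).
have smaller (E : {set W}) c : c \in C -> E \subset C :\ c ->
    #|E| * #|V|.+1 + s.+1 < n.
  move=> cC /subset_leq_card; have := cardsD1 c C; rewrite cC => cardC leE.
  move: lt_n (lt_s); rewrite cardC add1n mulSn.
  by have := leq_mul2r #|V|.+1 #|E| #|C :\ c|; rewrite leE orbT; lia.
have [/existsP[c /andP[cC /forallP NP]]|no_c] := boolP [exists c in C,
    [forall i : I, K v (val i) ==> touches G [set c] (P i)]].
  have [||[P1 st1]|[E [P1 [EC st1]]]] :=
      state_extend (N := fun i => K v (val i)) st _ cC.
  - by rewrite cardI.
  - by move=> i Ni; have := NP i; rewrite Ni.
  - have [P2 st2] := @state_next w so _ _ uw st1.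
    exact: IHn (smaller _ c cC (subxx _)) wO lt_s st2.
  - by apply: IHn wO (ltnW lt_s) st1; apply: leq_trans (smaller _ c cC EC); rewrite ltnS leq_add2l.
(* Henceforth every vertex of [C] misses the part of some earlier neighbour of [v]. As [C] is
   nonempty, [v] has such a neighbour, and [s] is positive. *)
have not_c c : c \in C -> exists2 i : I, K v (val i) & ~~ touches G [set c] (P i).
  move=> cC; move: no_c; rewrite negb_exists => /forallP/(_ c); rewrite cC /=.
  by rewrite negb_forall => /existsP[i]; rewrite negb_imply => /andP[]; exists i.
have /set0Pn[c0 c0C] := state_nonempty st.
have [i0 i0N _] := not_c c0 c0C.
have s_gt0 : 0 < s by rewrite -cardI; apply/card_gt0P; exists i0.
have [BN2 BNadj] := rec_w so s_gt0.
have BNP (i : I) : (val i \in back_neighbors K w so) = K v (val i).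
  by rewrite inE (valP i).
have [/existsP[j /andP[ji jN]]|only] := boolP [exists j : I, (j != i0) && K v (val j)].
  have BN : back_neighbors K w so = [set val i0; val j].
    apply/eqP; rewrite eq_sym eqEcard subUset !sub1set !BNP i0N jN /=.
    by rewrite cards2 (inj_eq val_inj) eq_sym ji.
  have Kij : induced K (prefix_set w s) i0 j.
    apply: BNadj; rewrite ?BNP //; last by rewrite (inj_eq val_inj) eq_sym.
    by rewrite BN cards2 (inj_eq val_inj) eq_sym ji.
  (* [i0] and [j] are all the earlier neighbours of [v], so a vertex of [C] touching both parts
     would contradict [not_c]. *)
  have [|P1 st1] := state_contract st Kij.
    move=> c cC ci; have [k kN] := not_c c cC; apply: contra => cj.
    move: kN; rewrite -BNP BN !inE !(inj_eq val_inj) => /orP[]/eqP->//.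
  have [|w' w'O [f [g fK gK] fadj]] := conO w wO so s_gt0 i0 j _ i0N jN.
    by rewrite eq_sym.
  have st2 : state G #|V| (induced K (prefix_set w' (s - 1))) (P1 \o g) C.
    apply: state_reindex st1; first by exists f.
    by move=> x y; rewrite -fadj !gK.
  apply: IHn w'O _ st2; last by rewrite leq_subLR (leq_trans (ltnW lt_s)) // leq_addl.
  by move: lt_n; lia.
(* With [i0] the only earlier neighbour, linkage of [C] itself gives a vertex of [C] touching its
   part, contrary to [not_c]. *)
have /touchesP[c [y [cC yP cy]]] : touches G C (P i0).
  by apply: boundary_full; apply: state_linked st _ _ (state_nonempty st).
have [i iN /negP[]] := not_c c cC.
have -> : i = i0.
  apply: contraNeq only => ii0; apply/existsP; exists i; by rewrite ii0.
by apply/touchesP; exists c, y; rewrite set11.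
Qed.

Lemma rooted_model :
  contractibly_orderable K -> 0 < #|V| -> 0 < #|W| ->
  (forall x : W, #|V| <= degree G x) ->
  exists a P, [/\ packing G P [set a],
    forall x y, K x y -> touches G (P x) (P y) &
    forall x : V, touches G [set a] (P x)].
Proof.
move=> [Omega KO] V0 W0 deg; have [/set0Pn[w wO] recO _] := KO.
have [uw _] := recO w wO.
have no_i (i : {x : V | x \in prefix_set w 0}) : False.
  by have := valP i; rewrite inE take0.
apply: (@ordering_rooted Omega w 0 (fun=> set0) [set: W]) => //.
split=> [|i|c _|E _ _|].
- by split=> i; case: (no_i i).
- by case: (no_i i).
- apply: leq_trans (deg c) _; rewrite /degree.
  have inj : injective (@inl W {x : V | x \in prefix_set w 0}) by move=> ? ? [].
  rewrite -(card_imset _ inj).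
  apply/subset_leq_card/subsetP=> _ /imsetP[y cy ->]; rewrite !inE.
  move: cy; rewrite inE => cy; rewrite andbT; apply/andP; split.
    by apply: contraTneq cy => ->; rewrite adj_irrefl.
  by apply/touchesP; exists c, y; rewrite !set11.
- by rewrite card_prefix.
- by rewrite -card_gt0 cardsT.
Qed.

End Orderings.

(** * From minors to subdivisions *)

Section TopologicalEmbedding.
Variables (W I : finType) (G : sgraph W) (F : sgraph I).
Variables (f : I -> W) (p : I -> I -> seq W).
Hypothesis f_inj : injective f.
Hypothesis p_rev : forall x y, F x y -> p y x = rev (p x y).
Hypothesis p_path : forall x y, F x y -> path G (f x) (rcons (p x y) (f y)).
Hypothesis p_uniq : forall x y, F x y -> uniq (p x y).
Hypothesis p_internal : forall x y z, F x y -> f z \notin p x y.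
Hypothesis p_disjoint : forall x y x' y' u, F x y -> F x' y' ->
  u \in p x y -> u \in p x' y' -> x = x' /\ y = y' \/ x = y' /\ y = x'.

(** The subdivision is the union of the walks, with only their vertices and edges: [subdiv_vertex]
    and [subdiv_edge] rule out the induced subgraph of [G]. *)
Let used (u : W) :=
  [exists x, u == f x] || [exists x, exists y, F x y && (u \in p x y)].
Let U := {u : W | used u}.
Let walk x y := f x :: rcons (p x y) (f y).
Let walk_edge u v := [exists x, exists y, F x y && infix [:: u; v] (walk x y)].

Lemma infix2_path (e : rel W) x s u v :
  path e x s -> infix [:: u; v] (x :: s) -> e u v.
Proof.
move=> es /infixP[s1 [s2 eq_s]]; have : sorted e (x :: s) by [].
by rewrite eq_s => /cat_sorted2[_] /= /andP[].
Qed.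

Lemma path_infix2 x (s : seq W) : path (fun u v => infix [:: u; v] (x :: s)) x s.
Proof.
suff H (s1 s2 : seq W) y : path (fun u v => infix [:: u; v] (s1 ++ y :: s2)) y s2.
  exact: (H [::] s).
elim: s2 s1 y => //= z s2 IH s1 y; rewrite -cat_rcons IH andbT cat_rcons.
by apply/infixP; exists s1, s2.
Qed.

Lemma walk_edge_sym : symmetric walk_edge.
Proof.
have H u v : walk_edge u v -> walk_edge v u.
  case/existsP=> x /existsP[y /andP[xy uv]]; apply/existsP; exists y.
  apply/existsP; exists x; rewrite adj_sym xy /walk (p_rev xy) andTb.
  have -> : f y :: rcons (rev (p x y)) (f x) = rev (walk x y).
    by rewrite rev_cons rev_rcons.
  by rewrite -[[:: v; u]]/(rev [:: u; v]) infix_rev.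
by move=> u v; apply/idP/idP; apply: H.
Qed.

Lemma walk_edge_sub : subrel walk_edge G.
Proof.
by move=> u v /existsP[x /existsP[y /andP[xy]]]; apply/infix2_path/p_path.
Qed.

Lemma walk_edge_irrefl : irreflexive walk_edge.
Proof. by move=> u; apply: contraFF (adj_irrefl G u); apply: walk_edge_sub. Qed.

Let F' : sgraph U :=
  @SGraph U (relpre val walk_edge) (fun u v => walk_edge_sym (val u) (val v))
    (fun u => walk_edge_irrefl (val u)).

Lemma contains_subdivision_of_paths : contains_subdivision G F.
Proof.
have used_f x : used (f x) by apply/orP; left; apply/existsP; exists x.
have used_p x y u : F x y -> u \in p x y -> used u.
  by move=> xy up; apply/orP; right; apply/existsP; exists x; apply/existsP; exists y; rewrite xy.
pose f' x : U := Sub (f x) (used_f x).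
(* Nothing is dropped by [pmap], since all vertices of [p x y] are used when [F x y] holds. *)
pose p' x y : seq U := pmap insub (p x y).
have p'K x y : F x y -> map val (p' x y) = p x y.
  move=> xy; rewrite pmap_filter; last exact: insubK.
  by apply/all_filterP/allP => u /(used_p _ _ _ xy) Uu; rewrite insubT.
have mem_p' x y u : F x y -> (u \in p' x y) = (val u \in p x y).
  by move=> xy; rewrite -(p'K _ _ xy) (mem_map val_inj).
have walkE x y : F x y -> map val (f' x :: rcons (p' x y) (f' y)) = walk x y.
  by move=> xy; rewrite /= map_rcons p'K.
exists U, F'; split; last by exists val => [|u v uv]; [apply: val_inj | apply: walk_edge_sub].
exists f', p'; split.
- by move=> x y /(congr1 val)/f_inj.
- move=> x y xy; apply: (inj_map val_inj).
  have yx : F y x by rewrite adj_sym.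
  by rewrite map_rev (p'K _ _ xy) (p'K _ _ yx) p_rev.
- move=> x y xy; rewrite -[path _ _ _](path_map (f := val) (e' := walk_edge)) map_rcons p'K //.
  apply: sub_path (path_infix2 _ _) => u v uv.
  by apply/existsP; exists x; apply/existsP; exists y; rewrite xy.
- by move=> x y xy; rewrite -(map_inj_uniq val_inj) p'K // p_uniq.
- by move=> x y z xy; rewrite mem_p' // p_internal.
- by move=> x y x' y' u xy xy'; rewrite !mem_p' //; apply: p_disjoint.
- move=> u; case/orP: (valP u) => /existsP[x].
    by move/eqP=> ux; left; exists x; apply: val_inj.
  by case/existsP=> y /andP[xy uxy]; right; exists x, y; rewrite mem_p'.
- move=> u v /existsP[x /existsP[y /andP[xy]]]; rewrite -walkE // => uv.
  exists x, y; split=> //; case/infixP: uv => s1 [s2 eq_s].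
  apply/infixP.
  move: eq_s; set s := f' x :: _ => eq_s.
  exists (take (size s1) s), (drop (size s1).+2 s).
  apply: (inj_map val_inj); rewrite !map_cat map_take map_drop eq_s.
  by rewrite take_size_cat // -[(size s1).+2]/(2 + size s1) -drop_drop drop_size_cat //= drop0.
Qed.

End TopologicalEmbedding.

(** * Subdivided stars with at most three legs in a connected set *)

Section Spiders.
Variables (W : finType) (G : sgraph W) (A : {set W}).
Hypothesis cA : connected G A.

(** The centre [z] is left out of [q], so that legs with a common centre can be disjoint lists. *)
Definition leg z q e :=
  [/\ path G z q, last z q = e, uniq (z :: q) & {subset z :: q <= A}].

Lemma connected_leg x y : x \in A -> y \in A -> exists q, leg x q y.
Proof.
move=> xA yA; have /connectP[q0 q0P ->] := cA.2 x y xA yA.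
case/shortenP: q0P => q qP q_uniq _; exists q; split=> //.
  by apply: sub_path qP => u v /and3P[].
move=> z; rewrite inE => /predU1P[->//|].
elim: q x {xA q_uniq} qP => //= u q IH x /andP[/and3P[_ uA _] /IH{}IH].
by rewrite inE => /predU1P[->|].
Qed.

(** The path is cut at [z] and its first piece reversed; [behead] and [head] let [s1] be empty, in
    which case [x] is [z]. *)
Lemma leg_rev x s1 z s2 y :
  leg x (behead (rcons s1 z ++ s2)) y -> x = head z s1 -> leg z (rev s1) x.
Proof.
move=> [qP _ q_uniq qA] xE.
have eq_s : x :: behead (rcons s1 z ++ s2) = rcons s1 z ++ s2 by rewrite xE; case: (s1).
rewrite eq_s in q_uniq qA.
have : sorted G (rcons s1 z ++ s2) by rewrite -eq_s.
case/cat_sorted2 => s_sorted _; split.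
- have : sorted G (rev (rcons s1 z)).
    by rewrite rev_sorted; apply: sub_sorted s_sorted => u v; rewrite adj_sym.
  by rewrite rev_rcons.
- by rewrite xE; case: (s1) => [|u s] //=; rewrite rev_cons last_rcons.
- by rewrite -rev_rcons rev_uniq; move: q_uniq; rewrite cat_uniq => /andP[].
- by move=> u; rewrite -rev_rcons mem_rev => us; apply: qA; rewrite mem_cat us.
Qed.

(** Take a path from [e1] to [e2], and follow a path from [e3] towards [e1] up to its first vertex
    [z] on the former. The three pieces meeting at [z] are the legs. *)
Lemma spider3 e1 e2 e3 : e1 \in A -> e2 \in A -> e3 \in A ->
  exists z q1 q2 q3, [/\ leg z q1 e1, leg z q2 e2, leg z q3 e3 &
    [/\ ~~ has (mem q1) q2, ~~ has (mem q1) q3 & ~~ has (mem q2) q3]].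
Proof.
move=> A1 A2 A3; have [p legp] := connected_leg A1 A2.
have [r legr] := connected_leg A3 A1.
have hit : has (mem (e1 :: p)) (e3 :: r).
  have [_ r1 _ _] := legr; apply/hasP; exists e1; last exact: mem_head.
  by rewrite -r1 mem_last.
have [z [s1 [s2 [def_r zp s1p]]]] : exists z s1 s2,
    [/\ e3 :: r = rcons s1 z ++ s2, z \in e1 :: p & ~~ has (mem (e1 :: p)) s1].
  by case/split_find: hit => z s1 s2; exists z, s1, s2.
case def_p: {1}_ / (splitPr zp) => [t1 t2].
have [pP p2 p_uniq pA] := legp.
rewrite def_p in p_uniq pA.
exists z, (rev t1), t2, (rev s1); split.
- apply: (@leg_rev _ _ _ t2 e2); first by rewrite cat_rcons -def_p.
  by case: (t1) def_p => [|? ?] [].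
- have : sorted G (e1 :: p) by [].
  rewrite def_p => /cat_sorted2[_ t2P]; split=> //.
  + by rewrite -p2 -[last e1 p]/(last e1 (e1 :: p)) def_p last_cat.
  + by move: p_uniq; rewrite cat_uniq => /and3P[].
  + by move=> u ut; apply: pA; rewrite mem_cat ut orbT.
- apply: (@leg_rev _ _ _ s2 e1); first by rewrite -def_r.
  by case: (s1) def_r => [|? ?] [].
split.
- move: p_uniq; rewrite cat_uniq => /and3P[_ /hasPn t_dis _]; apply/hasPn=> u ut.
  by rewrite /= mem_rev; apply: (t_dis u); rewrite inE ut orbT.
- apply/hasPn=> u; rewrite /= !mem_rev => /(hasPn s1p); rewrite /= def_p.
  by apply: contra => ut; rewrite mem_cat ut.
- apply/hasPn=> u; rewrite /= !mem_rev => /(hasPn s1p); rewrite /= def_p.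
  by apply: contra => ut; rewrite mem_cat inE ut !orbT.
Qed.

Lemma spider (I : finType) (J : {set I}) (e : I -> W) :
  #|J| <= 3 -> {in J, forall y, e y \in A} ->
  exists zq : W * (I -> seq W), [/\ zq.1 \in A,
    {in J, forall y, leg zq.1 (zq.2 y) (e y)} &
    {in J &, forall y y' u, u \in zq.2 y -> u \in zq.2 y' -> y = y'}].
Proof.
move=> J3 eA; have [J0|[y0 y0J]] := set_0Vmem J.
  have /set0Pn[z zA] := cA.1; exists (z, fun=> [::]).
  by rewrite J0; split=> // y; rewrite inE.
(* Indices are repeated if [J] has fewer than three elements; [q] below then uses the first matching
   leg. *)
have [y1 [y2 [y3 [y1J y2J y3J Jsub]]]] : exists y1 y2 y3,
    [/\ y1 \in J, y2 \in J, y3 \in J & forall y, y \in J -> y \in [:: y1; y2; y3]].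
  have memJ y : (y \in J) = (y \in enum J) by rewrite mem_enum.
  move: J3 y0J; rewrite memJ cardE.
  case: (enum J) memJ => [|y1 [|y2 [|y3 []]]] // memJ _ _.
  - by exists y1, y1, y1; split=> [|||y]; rewrite memJ !inE ?eqxx // => ->.
  - by exists y1, y2, y2; split=> [|||y]; rewrite memJ !inE ?eqxx ?orbT // => /orP[]->; rewrite ?orbT.
  - by exists y1, y2, y3; split=> [|||y]; rewrite memJ !inE ?eqxx ?orbT.
have [z [q1 [q2 [q3 [l1 l2 l3 [d12 d13 d23]]]]]] := spider3 (eA _ y1J) (eA _ y2J) (eA _ y3J).
pose q y := if y == y1 then q1 else if y == y2 then q2 else q3.
have qE y : y \in J -> [\/ y = y1 /\ q y = q1, y = y2 /\ q y = q2 | y = y3 /\ q y = q3].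
  move=> /Jsub; rewrite !inE /q.
  have [->|_] := eqVneq y y1; first by constructor 1.
  have [->|_] := eqVneq y y2; first by constructor 2.
  by move/eqP->; constructor 3.
exists (z, q); split=> /=.
- by case: l1 => _ _ _; apply; rewrite inE eqxx.
- by move=> y /qE[][-> ->].
- have dis (s1 s2 : seq W) u : ~~ has (mem s1) s2 -> u \in s1 -> u \in s2 -> False.
    by move=> /hasPn s12 us1 /s12; rewrite /= us1.
  move=> y y' /qE[][-> ->] /qE[][-> ->] u // us us'.
  + by case: (dis _ _ u d12).
  + by case: (dis _ _ u d13).
  + by case: (dis _ _ u d12).
  + by case: (dis _ _ u d23).
  + by case: (dis _ _ u d13).
  + by case: (dis _ _ u d23).
Qed.

End Spiders.

Section MinorToSubdivision.
Variables (W I : finType) (G : sgraph W) (F : sgraph I) (P : I -> {set W}).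
Hypothesis P_connected : forall i, connected G (P i).
Hypothesis P_inj : forall i j x, x \in P i -> x \in P j -> i = j.
Hypothesis P_adj : forall i j, F i j -> touches G (P i) (P j).

Lemma edge_ends : exists e : I -> I -> W,
  forall i j, F i j -> e i j \in P i /\ G (e i j) (e j i).
Proof.
have [w0|W0] := pickP (mem W); last first.
  have noI (i : I) : False.
    by have [/set0Pn[x _] _] := P_connected i; have := W0 x.
  by exists (fun i => match noI i with end) => i; case: (noI i).
move=> _.
pose pk (A B : {set W}) : W * W :=
  odflt (w0, w0) [pick z | [&& z.1 \in A, z.2 \in B & G z.1 z.2]].
have pkP A B : touches G A B ->
    [/\ (pk A B).1 \in A, (pk A B).2 \in B & G (pk A B).1 (pk A B).2].
  case/touchesP=> x [y [xA yB xy]]; rewrite /pk.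
  by case: pickP => [z /and3P[]|/(_ (x, y))] //=; rewrite xA yB xy.
(* The ranks orient each edge, so that [e i j] and [e j i] are the two ends of one chosen edge of
   [G]. *)
pose e i j := if enum_rank i < enum_rank j then (pk (P i) (P j)).1
              else (pk (P j) (P i)).2.
exists e => i j ij; rewrite /e; have ji : F j i by rewrite adj_sym.
have [a1 a2 a3] := pkP _ _ (P_adj ij); have [b1 b2 b3] := pkP _ _ (P_adj ji).
case: ltngtP => [_|_|/val_inj/enum_rank_inj eij]; split=> //.
  by rewrite adj_sym.
by move: ij; rewrite eij adj_irrefl.
Qed.

(* A part with at most three neighbouring parts contains a subdivided star
   joining the ends of the corresponding edges; these stars replace the parts. *)
Lemma subdivision_of_minor :
  (forall i, degree F i <= 3 \/ exists a, P i = [set a]) ->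
  contains_subdivision G F.
Proof.
move=> degF; have [e eP] := edge_ends.
have [zq zqP] : exists zq : I -> W * (I -> seq W), forall i, [/\ (zq i).1 \in P i,
    {in [set j | F i j], forall j, leg G (P i) (zq i).1 ((zq i).2 j) (e i j)} &
    {in [set j | F i j] &, forall j j' u,
       u \in (zq i).2 j -> u \in (zq i).2 j' -> j = j'}].
  apply: (fin_all_exists (P := fun i zq => [/\ zq.1 \in P i,
    {in [set j | F i j], forall j, leg G (P i) zq.1 (zq.2 j) (e i j)} &
    {in [set j | F i j] &, forall j j' u,
       u \in zq.2 j -> u \in zq.2 j' -> j = j'}])) => i.
  case: (degF i) => [d3|[a Pi]].
    by apply: spider => // j; rewrite inE => /eP[].
  (* In a part [[set a]] every edge end is [a], so empty legs suffice whatever the degree. *)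
  exists (a, fun=> [::]); split=> //= [|j]; first by rewrite Pi set11.
  rewrite inE => /eP[]; rewrite Pi => /set1P-> _; split=> //.
  by move=> u; rewrite !inE.
pose f i := (zq i).1; pose q i j := (zq i).2 j.
have fP i : f i \in P i by case: (zqP i).
have legP i j : F i j -> leg G (P i) (f i) (q i j) (e i j).
  by move=> ij; case: (zqP i) => _ + _; apply; rewrite inE.
have qP i j u : F i j -> u \in q i j -> u \in P i.
  by move=> /legP[_ _ _ sub] uq; apply: sub; rewrite inE uq orbT.
have q_inj i j i' j' u : F i j -> F i' j' -> u \in q i j -> u \in q i' j' ->
    i = i' /\ j = j'.
  move=> ij ij' uq uq'; have eqi := P_inj (qP _ _ _ ij uq) (qP _ _ _ ij' uq').
  move: ij' uq'; rewrite -eqi => ij' uq'; split=> //.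
  by case: (zqP i) => _ _ /(_ j j' _ _ u); apply; rewrite ?inE.
have symF i j : F i j -> F j i by rewrite adj_sym.
(* The path for [ij] runs along the leg to [e i j], crosses to [e j i], and follows the other leg
   backwards to the centre of [P j]. *)
apply: (@contains_subdivision_of_paths W I G F f (fun i j => q i j ++ rev (q j i))).
- by move=> i j fij; apply: P_inj (fP i) _; rewrite fij.
- by move=> i j ij; rewrite rev_cat revK.
- move=> i j ij; have [p1 l1 _ _] := legP i j ij.
  have [p2 l2 _ _] := legP j i (symF i j ij).
  rewrite rcons_cat cat_path p1 l1 -rev_cons lastI rev_rcons /= l2.
  rewrite (eP i j ij).2 -l2 rev_path.
  by apply: sub_path p2 => u v; rewrite /= adj_sym.
- move=> i j ij; have [_ _ /= /andP[_ u1] _] := legP i j ij.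
  have [_ _ /= /andP[_ u2] _] := legP j i (symF i j ij).
  rewrite cat_uniq u1 rev_uniq u2 andbT; apply/hasPn=> u; rewrite mem_rev => uj.
  apply/negP => ui; have := q_inj _ _ _ _ _ ij (symF _ _ ij) ui uj.
  by case=> eij _; move: ij; rewrite eij adj_irrefl.
- have f_q i j k : F i j -> f k \notin q i j.
    move=> ij; apply/negP => fk; have ki := P_inj (fP k) (qP _ _ _ ij fk).
    by move: fk; rewrite ki; have [_ _ /= /andP[/negP]] := legP i j ij.
  by move=> i j k ij; rewrite mem_cat mem_rev negb_or !f_q // symF.
- move=> i j i' j' u ij ij'; rewrite !mem_cat !mem_rev.
  have [ji ji'] := (symF i j ij, symF i' j' ij').
  case/orP=> uq /orP[]uq'.
  + by left; apply: (q_inj _ _ _ _ u ij ij').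
  + by right; apply: (q_inj _ _ _ _ u ij ji').
  + by right; have [-> ->] := q_inj _ _ _ _ u ji ij' uq uq'.
  + by left; have [-> ->] := q_inj _ _ _ _ u ji ji' uq uq'.
Qed.

End MinorToSubdivision.

Theorem corollary1p9 (V : finType) (H K : sgraph V)
    (V_nonempty : 0 < #|V|)
    (H_subcubic : subcubic H)
    (H_spanning : spanning_subgraph H K)
    (K_orderable : contractibly_orderable K)
    (W : finType) (G : sgraph W)
    (W_nonempty : 0 < #|W|)
    (G_mindeg : forall w : W, #|{: option V}| - 1 <= degree G w) :
  contains_subdivision G (star H).
Proof.
have degG w : #|V| <= degree G w.
  by apply: leq_trans (G_mindeg w); rewrite card_option subn1.
have [a [P [[conP injP offP] adjP aP]]] := rooted_model K_orderable V_nonempty W_nonempty degG.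
pose P' x := if x is Some v then P v else [set a].
apply: (@subdivision_of_minor W (option V) G (star H) P').
- by case=> [v|]; [apply: conP | apply: connected1].
- move=> [u|] [v|] x //=.
  + by move=> xu xv; rewrite (injP _ _ _ xu xv).
  + by move=> /offP/negP xu /xu.
  + by move=> xa /offP/negP[].
- move=> [u|] [v|] //= uv; first exact/adjP/H_spanning.
  by rewrite touchesC.
- move=> [v|]; [left | by right; exists a].
  (* A vertex of degree three in [H] is not joined to [None]; any other has at most two neighbours
     in [H] besides [None]. *)
  rewrite /degree; have [d3|d2] := ltnP 2 (degree H v).
    apply: leq_trans (H_subcubic v); rewrite /degree.
    have inj : injective (@Some V) by move=> ? ? [].
    rewrite -(card_imset _ inj); apply/subset_leq_card/subsetP=> -[u|].
      by rewrite !inE => vu; apply: imset_f; rewrite inE.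
    by rewrite inE /= leqNgt d3.
  apply: leq_trans (_ : #|None |: [set Some u | u in [set u | H v u]]| <= 3).
    apply/subset_leq_card/subsetP=> -[u|]; rewrite !inE //= => vu.
    by apply: imset_f; rewrite inE.
  apply: leq_trans (leq_card_setU _ _) _; rewrite cards1 add1n ltnS.
  exact: leq_trans (leq_imset_card _ _) d2.
Qed.
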